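(* Let $\mathbb K$ be the field of real or complex numbers, let $\mathbf X$ be a non-empty set, and let $\mathcal D(\mathbf X)$ be the set of all metrics on $\mathbf X$ together with the constant zero function $O:\mathbf X\times\mathbf X\to[0,\infty)$. For $\rho,\eta\in\mathcal D(\mathbf X)$ and $\alpha\in\mathbb K$ define $(\rho+\eta)(x,y):=\rho(x,y)+\eta(x,y)$ and $(\alpha\rho)(x,y):=|\alpha|\,\rho(x,y)$ for all $x,y\in\mathbf X$, and define $\rho\le\eta$ iff $\rho(x,y)\le\eta(x,y)$ for all $x,y\in\mathbf X$. Then $\mathcal D(\mathbf X)$, with these operations and this partial order, is an exponential vector space over $\mathbb K$.
   Context: An exponential vector space (evs) over a field $K$ is a partially ordered set $(X,\le)$ with a binary operation $+$ on $X$ and a scalar multiplication $\cdot:K\times X\to X$ such that: ($A_1$) $(X,+)$ is a commutative semigroup with identity $\theta$; ($A_2$) $x\le y$ implies $x+z\le y+z$ and $\alpha\cdot x\le\alpha\cdot y$ for all $z\in X$, $\alpha\in K$; ($A_3$) for all $x,y\in X$, $\alpha,\beta\in K$: (i) $\alpha\cdot(x+y)=\alpha\cdot x+\alpha\cdot y$; (ii) $\alpha\cdot(\beta\cdot x)=(\alpha\beta)\cdot x$; (iii) $(\alpha+\beta)\cdot x\le\alpha\cdot x+\beta\cdot x$; (iv) $1\cdot x=x$; ($A_4$) $\alpha\cdot x=\theta$ iff $\alpha=0$ or $x=\theta$; ($A_5$) $x+(-1)\cdot x=\theta$ iff $x\in X_0:=\{z\in X: y\not\le z\ \ \forall y\in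 X\setminus\{z\}\}$ (the set of minimal elements); ($A_6$) for each $x\in X$ there exists $p\in X_0$ with $p\le x$. *)

(* Defs.v *)
From mathcomp Require Import all_boot all_order all_algebra.
From mathcomp Require Import all_classical all_reals.

Set Implicit Arguments.
Unset Strict Implicit.
Unset Printing Implicit Defensive.

Import Order.TTheory GRing.Theory Num.Theory.

Local Open Scope classical_set_scope.
Local Open Scope ring_scope.

(* An algebraic structure is given by a carrier [E : set T] together with
   operations and an order on the ambient type [T], all of whose axioms are
   relativized to [E]; that the operations restrict to [E] is one of the
   axioms. *)

Definition minimals {T : Type} (E : set T) (le : T -> T -> Prop) : set T :=
  [set z | E z /\ forall y, (E `\ z) y -> ~ le y z].

Record partial_order_on {T : Type} (E : set T) (le : T -> T -> Prop) : Prop := {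
  le_on_refl : forall x, E x -> le x x ;
  le_on_anti : forall x y, E x -> E y -> le x y -> le y x -> x = y ;
  le_on_trans : forall x y z, E x -> E y -> E z -> le x y -> le y z -> le x z }.

Record evs_axioms {K : fieldType} {T : Type} (E : set T) (le : T -> T -> Prop)
    (add : T -> T -> T) (scale : K -> T -> T) (theta : T) : Prop := {
  evs_order : partial_order_on E le ;
  evs_add_closed : forall x y, E x -> E y -> E (add x y) ;
  evs_scale_closed : forall a x, E x -> E (scale a x) ;
  evs_addA : forall x y z, E x -> E y -> E z ->
    add x (add y z) = add (add x y) z ;
  evs_addC : forall x y, E x -> E y -> add x y = add y x ;
  evs_theta : E theta ;
  evs_add0 : forall x, E x -> add theta x = x ;
  evs_le_add : forall x y z, E x -> E y -> E z ->
    le x y -> le (add x z) (add y z) ;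
  evs_le_scale : forall a x y, E x -> E y ->
    le x y -> le (scale a x) (scale a y) ;
  evs_scaleDr : forall a x y, E x -> E y ->
    scale a (add x y) = add (scale a x) (scale a y) ;
  evs_scaleA : forall a b x, E x -> scale a (scale b x) = scale (a * b) x ;
  evs_scaleDl : forall a b x, E x ->
    le (scale (a + b) x) (add (scale a x) (scale b x)) ;
  evs_scale1 : forall x, E x -> scale 1 x = x ;
  evs_scale_eq0 : forall a x, E x ->
    scale a x = theta <-> a = 0 \/ x = theta ;
  evs_add_opp : forall x, E x ->
    add x (scale (- 1) x) = theta <-> minimals E le x ;
  evs_minimal : forall x, E x -> exists p, minimals E le p /\ le p x }.

Definition is_evs {K : fieldType} {T : Type} (E : set T) (le : T -> T -> Prop)
    (add : T -> T -> T) (scale : K -> T -> T) : Prop :=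
  exists theta, evs_axioms E le add scale theta.

Record is_metric {R : realType} {X : Type} (rho : X * X -> R) : Prop := {
  metric_ge0 : forall x y, 0 <= rho (x, y) ;
  metric_eq0 : forall x y, rho (x, y) = 0 <-> x = y ;
  metric_sym : forall x y, rho (x, y) = rho (y, x) ;
  metric_triangle : forall x y z, rho (x, z) <= rho (x, y) + rho (y, z) }.

Definition metrics_or_zero (R : realType) (X : Type) : set (X * X -> R) :=
  [set rho | is_metric rho] `|` [set cst 0].
Arguments metrics_or_zero : clear implicits.

Definition metric_le {R : realType} {X : Type} (rho eta : X * X -> R) : Prop :=
  forall x y, rho (x, y) <= eta (x, y).

Definition metric_add {R : realType} {X : Type} (rho eta : X * X -> R) :
  X * X -> R := fun xy => rho xy + eta xy.

(* [abs] is the modulus of the scalar field [K], with values in [R]. *)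
Definition metric_scale {R : realType} {X : Type} {K : fieldType} (abs : K -> R)
  (a : K) (rho : X * X -> R) : X * X -> R := fun xy => abs a * rho xy.

(* Main.v *)
(** The zero function [O] is the least element of [D(X)], hence its only minimal
    element; every axiom then reduces to a pointwise property of nonnegative
    reals and of the modulus of the scalar field. *)

Require Import Defs.
From mathcomp Require Import all_boot all_order all_algebra.
From mathcomp Require Import all_classical all_reals complex.

Import Order.TTheory GRing.Theory Num.Theory.

Local Open Scope ring_scope.
Local Open Scope complex_scope.

Lemma metrics_or_zero_ge0 (R : realType) (X : Type) (rho : X * X -> R) :
  metrics_or_zero R X rho -> forall xy, 0 <= rho xy.
Proof. by case=> [h [x y]|-> //]; exact: metric_ge0 h x y. Qed.

(** If either summand is [O], the sum is the other summand; otherwise the metric axioms add up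
    pointwise. *)
Lemma metrics_or_zero_add (R : realType) (X : Type) (rho eta : X * X -> R) :
  metrics_or_zero R X rho -> metrics_or_zero R X eta ->
  metrics_or_zero R X (metric_add rho eta).
Proof.
case=> [hr|->]; last first.
  by have -> : metric_add (cst 0) eta = eta by apply/funext => xy; exact: add0r.
case=> [he|->]; last first.
  have -> : metric_add rho (cst 0) = rho by apply/funext => xy; exact: addr0.
  by left.
left; split=> [x y|x y|x y|x y z]; rewrite /metric_add.
- by rewrite addr_ge0 ?(metric_ge0 hr) ?(metric_ge0 he).
(* A sum of nonnegative reals vanishes only if each term does, so the definiteness of [rho] already
   gives [x = y]. *)
- split=> [/eqP|xy].
    rewrite paddr_eq0 ?(metric_ge0 hr) ?(metric_ge0 he) // => /andP[/eqP r0 _].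
    exact/(metric_eq0 hr).
  by rewrite (metric_eq0 hr x y).2 ?(metric_eq0 he x y).2 ?addr0.
- by rewrite (metric_sym hr) (metric_sym he).
- by rewrite addrACA lerD ?(metric_triangle hr) ?(metric_triangle he).
Qed.

(** This turns the two axioms about minimal elements into statements about [O] alone. *)
Lemma minimals_metrics_or_zero (R : realType) (X : Type) (rho : X * X -> R) :
  minimals (metrics_or_zero R X) metric_le rho <-> rho = cst 0.
Proof.
split=> [[Er min_rho]|->].
  apply: contrapT => rho0; apply: (min_rho (cst 0)).
    by split; [right | move=> /= e; apply: rho0].
  by move=> x y; exact: (metrics_or_zero_ge0 _ _ _ Er).
split=> [|eta [Ee eta0] le_eta0]; first by right.
apply: eta0; apply/funext => -[x y] /=; apply/le_anti.
by rewrite (metrics_or_zero_ge0 _ _ _ Ee) andbT; exact: le_eta0.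
Qed.

(** The modulus is abstracted to a multiplicative, subadditive, definite map [abs], so that the real
    and complex cases share one proof. *)
Lemma is_evs_metrics_or_zero (R : realType) (X : Type) (K : fieldType)
    (abs : K -> R) (abs_ge0 : forall a, 0 <= abs a)
    (abs_eq0 : forall a, abs a = 0 <-> a = 0)
    (absM : forall a b, abs (a * b) = abs a * abs b)
    (abs_add : forall a b, abs (a + b) <= abs a + abs b) :
  is_evs (metrics_or_zero R X) metric_le metric_add (metric_scale abs).
Proof.
have abs0 : abs 0 = 0 by apply/abs_eq0.
have abs1 : abs 1 = 1.
  (* Multiplicativity makes [abs 1] idempotent, and a nonzero idempotent of a field is 1. *)
  have abs1_neq0 : abs 1 != 0.
    by apply/eqP => /abs_eq0/eqP; rewrite oner_eq0.
  by apply: (mulIf abs1_neq0); rewrite -absM !mul1r.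
have absN1 : abs (- 1) = 1.
  (* [abs (- 1)] is a nonnegative real whose square is [abs 1 = 1]. *)
  by apply/eqP; rewrite -sqrp_eq1 // expr2 -absM mulrNN mulr1 abs1.
exists (cst 0); split.
- split=> [rho _ x y //|rho eta _ _ re er|rho eta z _ _ _ re ez x y].
    by apply/funext => -[x y]; apply/le_anti; rewrite re er.
  exact: le_trans (re x y) (ez x y).
- exact: metrics_or_zero_add.
- move=> a rho [hr|->]; last first.
    by right; apply/funext => xy; exact: mulr0.
  (* A zero scalar collapses a metric to [O]; any other scalar preserves definiteness. *)
  have [a0|a0] := eqVneq (abs a) 0.
    by right; apply/funext => xy; rewrite /metric_scale a0 mul0r.
  left; split=> [x y|x y|x y|x y z]; rewrite /metric_scale.
  + by rewrite mulr_ge0 ?(metric_ge0 hr).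
  + split=> [/eqP|/(metric_eq0 hr) ->]; last exact: mulr0.
    by rewrite mulf_eq0 (negPf a0) => /eqP/(metric_eq0 hr).
  + by rewrite (metric_sym hr).
  + by rewrite -mulrDr ler_wpM2l ?(metric_triangle hr).
- by move=> rho eta z _ _ _; apply/funext => xy; exact: addrA.
- by move=> rho eta _ _; apply/funext => xy; exact: addrC.
- by right.
- by move=> rho _; apply/funext => xy; exact: add0r.
- by move=> rho eta z _ _ _ re x y; rewrite lerD2r.
- by move=> a rho eta _ _ re x y; rewrite ler_wpM2l.
- by move=> a rho eta _ _; apply/funext => xy; exact: mulrDr.
- by move=> a b rho _; apply/funext => xy; rewrite /metric_scale absM mulrA.
(* With the common factor [rho (x, y) >= 0] pulled out, this is the subadditivity of [abs]. *)
- move=> a b rho Er x y; rewrite /metric_add /metric_scale -mulrDl.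
  by rewrite ler_wpM2r // (metrics_or_zero_ge0 _ _ _ Er).
- by move=> rho _; apply/funext => xy; rewrite /metric_scale abs1 mul1r.
- move=> a rho _; split=> [ar0|[->|->]]; last 2 first.
  + by apply/funext => xy; rewrite /metric_scale abs0 mul0r.
  + by apply/funext => xy; exact: mulr0.
  have [/abs_eq0 ?|a0] := eqVneq (abs a) 0; [by left | right].
  apply/funext => xy; apply: (mulfI a0); rewrite mulr0.
  by have /(congr1 (@^~ xy)) := ar0.
- move=> rho Er; rewrite minimals_metrics_or_zero; split=> [r0|->]; last first.
    by apply/funext => xy; rewrite /metric_add /metric_scale /= mulr0 addr0.
  (* Since [abs (- 1) = 1], the hypothesis at [xy] reads [rho xy + rho xy = 0] with nonnegative
     terms. *)
  apply/funext => xy; have /(congr1 (@^~ xy)) /eqP := r0.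
  rewrite /metric_add /metric_scale absN1 mul1r /= paddr_eq0;
    rewrite ?(metrics_or_zero_ge0 _ _ _ Er) //.
  by move=> /andP[/eqP].
- move=> rho Er; exists (cst 0); split; first exact/minimals_metrics_or_zero.
  by move=> x y; exact: (metrics_or_zero_ge0 _ _ _ Er).
Qed.

Theorem theorem3p1 (R : realType) (X : Type) (X_nonempty : inhabited X) :
  is_evs (K := R) (metrics_or_zero R X) metric_le metric_add
    (metric_scale (fun a : R => `|a|)) /\
  is_evs (K := R[i]) (metrics_or_zero R X) metric_le metric_add
    (metric_scale (fun a : R[i] => Normc.normc a)).
Proof.
split; apply: is_evs_metrics_or_zero.
- by move=> a.
- by move=> a; split=> [/normr0_eq0|->]; rewrite ?normr0.
- exact: normrM.
- exact: ler_normD.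
(* Splitting the complex number into its parts exposes its modulus as a square root. *)
- by move=> [x y]; exact: sqrtr_ge0.
- move=> a; split=> [|->]; first exact: Normc.eq0_normc.
  exact: Normc.normc0.
- exact: Normc.normcM.
- exact: le_normcD.
Qed.
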